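(* Let $G$ be a finitely generated group of polynomial growth, and let $G \curvearrowright X$ be a minimal continuous action on a compact metrizable space $X$. Then the action has comparison: for all open sets $A, B \subseteq X$ such that $\mu(A) < \mu(B)$ for every $G$-invariant Borel probability measure $\mu$ on $X$, we have $A \prec B$.
   Context: For subsets $A, B \subseteq X$, $A$ is subequivalent to $B$, written $A \prec B$, if for every closed set $C \subseteq A$ there are finitely many open sets $U_1, \dots, U_n \subseteq X$ and elements $s_1, \dots, s_n \in G$ such that $C \subseteq \bigcup_{i=1}^n U_i$ and the sets $s_1U_1, \dots, s_nU_n$ are pairwise disjoint and contained in $B$. A finitely generated group has polynomial growth if, for the word metric with respect to some finite symmetric generating set, the balls $B_n$ of radius $n$ about the identity satisfy $|B_n| \le C n^d$ for some constants $C, d$ and all $n \ge 1$. *)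

(* Defs.v *)
From HB Require Import structures.
From Stdlib Require List.
From mathcomp Require Import all_boot all_order all_algebra.
From mathcomp Require Import all_classical all_reals all_analysis.
Set Implicit Arguments. Unset Strict Implicit. Unset Printing Implicit Defensive.
Import Order.TTheory GRing.Theory Num.Theory.
Local Open Scope classical_set_scope.

Section Defs.
Variable G : groupType.

Definition word_prod (w : seq G) : G := foldr (fun a b => (a * b)%g) 1%g w.

Definition word_ball (S : seq G) (n : nat) : set G :=
  [set g | exists w : seq G, (size w <= n)%N /\
     (forall a, List.In a w -> List.In a S) /\ g = word_prod w].

Definition generates (S : seq G) : Prop := forall g, exists n, word_ball S n g.

Definition symmetric_set (S : seq G) : Prop :=
  forall a, List.In a S -> List.In (a^-1)%g S.

Definition finitely_generated : Prop := exists S : seq G, generates S.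

Definition polynomial_growth : Prop :=
  exists S : seq G, symmetric_set S /\ generates S /\
    exists (C d : nat), forall n, (1 <= n)%N -> (word_ball S n #<= `I_(C * n ^ d))%card.

Variable X : ptopologicalType.
Variable act : G -> X -> X.

Definition continuous_action : Prop :=
  (forall x, act 1%g x = x) /\ (forall g h x, act (g * h)%g x = act g (act h x)) /\
  (forall g, continuous (act g)).

Definition orbit (x : X) : set X := [set act g x | g in [set: G]].

Definition minimal_action : Prop := forall x, closure (orbit x) = [set: X].

Definition subequivalent (A B : set X) : Prop :=
  forall C : set X, closed C -> C `<=` A ->
  exists (n : nat) (U : nat -> set X) (s : nat -> G),
    (forall i, (i < n)%N -> open (U i)) /\
    C `<=` \bigcup_(i in `I_n) U i /\
    (forall i j, (i < n)%N -> (j < n)%N -> i <> j ->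
       act (s i) @` U i `&` act (s j) @` U j = set0) /\
    (forall i, (i < n)%N -> act (s i) @` U i `<=` B).

Variable R : realType.

Definition metrizable : Prop :=
  exists d : X -> X -> R,
    (forall x y, 0 <= d x y)%R /\ (forall x y, d x y = 0%R <-> x = y) /\
    (forall x y, d x y = d y x) /\ (forall x y z, d x z <= d x y + d y z)%R /\
    (forall A : set X, open A <->
       forall x, A x -> exists2 e : R, (0 < e)%R & [set y | (d x y < e)%R] `<=` A).

Definition invariant_measure (mu : probability (g_sigma_algebraType (@open X)) R) : Prop :=
  forall g (A : set (g_sigma_algebraType (@open X))), measurable A -> mu (act g @^-1` A) = mu A.

End Defs.

(* Main.v *)
(* Let C be a closed subset of A. Put mass u on X (continuous, u = 1 on C,
supported in A) and capacity v < 1 (continuous, supported in B), and let group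
elements g act in turn: each x sends as much of its remaining mass as fits into
the remaining capacity of g x. Let a target choose the source that exhausts it
while still having mass to spare. This is an open condition, so it defines
disjoint open subsets of B; and a point of C is chosen as soon as it sends
anything, because its mass 1 exceeds the capacity of its first target. Working
with masses in this way makes boundaries harmless.

It remains to see that running through word balls of radii r_1 << ... << r_J
exhausts all the mass. If mu(A) < mu(B) for all invariant mu, then u and v can
be chosen so that, on balls that are large and sufficiently Følner, v exceeds u
by a definite density. Around a point with mass left after stage j, all capacity
in the ball of radius r_j is used up; earlier, shorter moves account only for
the mass of u near that ball, so a definite proportion was brought in at stage
j. By a Vitali covering argument the mass remaining before stage j is at least
(1 + c) times the mass remaining after it, up to enlarging the region by 2 r_j.
If some point keeps mass after stage J, this gives mass at least (1 + c)^(J-1)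
eps/2 |B(r_J)| within a ball of radius 4 r_J, which is impossible for large J
when the radii are chosen, by polynomial growth, with |B(4 r_J)| <= K |B(r_J)|.
*)

Require Import Defs.
From HB Require Import structures.
From mathcomp Require Import all_boot all_order all_algebra.
From mathcomp Require Import all_classical all_reals all_analysis.
From mathcomp Require Import zify ring lra.
Set Implicit Arguments. Unset Strict Implicit. Unset Printing Implicit Defensive.
Import Order.TTheory GRing.Theory Num.Theory.
Import numFieldNormedType.Exports.
Local Open Scope classical_set_scope.
Local Open Scope ring_scope.

(** * Greedy transport of mass *)

Lemma ler_sum_subset (R : numDomainType) (T : eqType) (P Q : seq T) (f : T -> R) :
  uniq P -> uniq Q -> {subset P <= Q} -> (forall x, x \in Q -> 0 <= f x) ->
  \sum_(x <- P) f x <= \sum_(x <- Q) f x.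
Proof.
move=> uP uQ PQ f0.
have pP : perm_eq [seq x <- Q | x \in P] P.
  apply: uniq_perm => //; first exact: filter_uniq.
  by move=> x; rewrite mem_filter; case: (boolP (x \in P)) => //= /PQ ->.
rewrite -(perm_big _ pP) big_filter [leRHS](bigID (mem P)) /=.
by rewrite lerDl big_seq_cond sumr_ge0// => x /andP[/f0].
Qed.

Lemma ler_sum_size (R : numDomainType) (T : eqType) (P : seq T) (f : T -> R) :
  (forall x, f x <= 1) -> \sum_(x <- P) f x <= (size P)%:R.
Proof.
move=> f1; elim: P => [|x P IH]; first by rewrite big_nil.
by rewrite big_cons /= -nat1r lerD.
Qed.

(** Monotonicity of sums in the index set, applied to [1 - f]. *)
Lemma ler_sum_superset (R : numDomainType) (T : eqType) (P Q : seq T) (f : T -> R) :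
  uniq P -> uniq Q -> {subset P <= Q} -> (forall x, f x <= 1) ->
  \sum_(x <- Q) f x <= \sum_(x <- P) f x + ((size Q)%:R - (size P)%:R).
Proof.
move=> uP uQ PQ f1.
have size_sum (s : seq T) : (size s)%:R = \sum_(x <- s) 1 :> R.
  by elim: s => [|x s IH]; rewrite ?big_nil// big_cons -IH nat1r.
have := ler_sum_subset uP uQ PQ (f := fun x => 1 - f x).
rewrite !sumrB -!size_sum -subr_ge0 => H.
rewrite -subr_ge0; apply: le_trans (H _) _; first by move=> x _; rewrite subr_ge0.
by rewrite le_eqVlt; apply/orP; left; apply/eqP; ring.
Qed.

Lemma sumr_const_seq (R : pzSemiRingType) (T : Type) (P : seq T) (c : R) :
  \sum_(x <- P) c = (size P)%:R * c.
Proof.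
by elim: P => [|x P IH]; rewrite ?big_nil ?mul0r// big_cons IH /= -nat1r mulrDl mul1r.
Qed.

Lemma expr_unbounded (R : archiRealFieldType) (c M : R) : 0 < c -> exists n, M < (1 + c) ^+ n.
Proof.
move=> c0; have bernoulli n : 1 + n%:R * c <= (1 + c) ^+ n.
  elim: n => [|n IH]; first by rewrite mul0r addr0 expr0.
  rewrite exprS -natr1; have n0 : 0 <= n%:R * c * c by rewrite !mulr_ge0 ?ler0n ?(ltW c0).
  by apply: le_trans (_ : (1 + c) * (1 + n%:R * c) <= _); [lra|rewrite ler_wpM2l//; lra].
exists (Num.bound `|M / c|); apply: lt_le_trans (bernoulli _).
rewrite ltr_wpDl// -ltr_pdivrMr//; apply: le_lt_trans (ler_norm _) _.
exact/archi_boundP/normr_ge0.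
Qed.

Section Greedy.
Variables (R : realType) (G : groupType) (X : Type) (act : G -> X -> X).
Hypothesis act1 : forall x, act 1%g x = x.
Hypothesis actM : forall g h x, act (g * h)%g x = act g (act h x).

Implicit Types (st : (X -> R) * (X -> R)) (g h : G) (gs : seq G).

(** A state holds the remaining mass [st.1] and the remaining capacity [st.2]; under the move [g],
    the source [x] serves the target [act g x]. *)
Definition sent st g (x : X) : R := Num.min (st.1 x) (st.2 (act g x)).

Definition step st g : (X -> R) * (X -> R) :=
  (fun x => st.1 x - sent st g x, fun x => st.2 x - sent st g (act (g^-1)%g x)).

Definition run st gs := foldl step st gs.

Definition nonneg st := (forall x, 0 <= st.1 x) /\ (forall x, 0 <= st.2 x).

Lemma actVK g x : act g (act (g^-1)%g x) = x.
Proof. by rewrite -actM mulgV act1. Qed.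

Lemma actKV g x : act (g^-1)%g (act g x) = x.
Proof. by rewrite -actM mulVg act1. Qed.

Lemma sent_ge0 st g x : nonneg st -> 0 <= sent st g x.
Proof. by case=> u0 v0; rewrite /sent le_min u0 v0. Qed.

Lemma step_nonneg st g : nonneg st -> nonneg (step st g).
Proof.
case=> u0 v0; split=> x /=; rewrite subr_ge0 /sent ge_min ?lexx //.
by rewrite actVK lexx orbT.
Qed.

Lemma run_nonneg st gs : nonneg st -> nonneg (run st gs).
Proof. by elim: gs st => //= g gs IH st /(step_nonneg g)/IH. Qed.

Lemma run_cat st s t : run st (s ++ t) = run (run st s) t.
Proof. exact: foldl_cat. Qed.

Lemma run_le st gs : nonneg st ->
  (forall x, (run st gs).1 x <= st.1 x) /\ (forall x, (run st gs).2 x <= st.2 x).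
Proof.
elim: gs st => [|g gs IH] st st0 //=.
have [H1 H2] := IH _ (step_nonneg g st0).
by split=> x; [apply: le_trans (H1 x) _|apply: le_trans (H2 x) _];
  rewrite /= gerBl sent_ge0.
Qed.

(** When [g] has its turn, either [x] loses all its mass or [act g x] all its capacity, and neither
    increases afterwards. *)
Lemma run_blocked st gs g x : nonneg st -> g \in gs ->
  0 < (run st gs).1 x -> (run st gs).2 (act g x) = 0.
Proof.
elim: gs st => [|k gs IH] st st0 //=; have st1 := step_nonneg k st0.
rewrite inE => /orP[/eqP <-|gin]; last exact: IH.
have [H1 H2] := run_le gs (step_nonneg g st0).
have [_ H0] := run_nonneg gs (step_nonneg g st0).
move=> upos; apply/eqP; rewrite eq_le H0 andbT.
apply: le_trans (H2 _) _; have := lt_le_trans upos (H1 x).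
rewrite /= actKV /sent; case: (leP (st.1 x) (st.2 (act g x))); first by rewrite subrr ltxx.
by rewrite subrr lexx.
Qed.

(** Capacity lost at [h] under the move [g] was filled from [g^-1 * h]. Summing over group elements
    instead of orbit points keeps multiplicities consistent when points have stabilizers. *)
Lemma run_transport st gs x0 (P Q : seq G) : nonneg st -> uniq P -> uniq Q ->
  (forall g h, g \in gs -> h \in P -> (g^-1 * h)%g \in Q) ->
  \sum_(h <- P) (st.2 (act h x0) - (run st gs).2 (act h x0)) <=
  \sum_(h <- Q) (st.1 (act h x0) - (run st gs).1 (act h x0)).
Proof.
move=> st0 uP uQ; elim: gs st st0 => [|g gs IH] st st0 PQ.
  by rewrite /= !big1 // => h _; rewrite subrr.
have /IH {}IH : forall k h, k \in gs -> h \in P -> (k^-1 * h)%g \in Q.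
  by move=> k h kg; apply: PQ; rewrite inE kg orbT.
have {IH} := IH _ (step_nonneg g st0); rewrite /=.
set r := run _ gs => IH.
have E1 : \sum_(h <- P) (st.2 (act h x0) - r.2 (act h x0)) =
   \sum_(h <- P) sent st g (act (g^-1 * h)%g x0) +
   \sum_(h <- P) ((step st g).2 (act h x0) - r.2 (act h x0)).
  by rewrite -big_split; apply: eq_bigr => h _ /=; rewrite actM; ring.
have E2 : \sum_(h <- Q) (st.1 (act h x0) - r.1 (act h x0)) =
   \sum_(h <- Q) sent st g (act h x0) +
   \sum_(h <- Q) ((step st g).1 (act h x0) - r.1 (act h x0)).
  by rewrite -big_split; apply: eq_bigr => h _ /=; ring.
rewrite E1 E2; apply: lerD IH.
rewrite -(big_map (fun h => g^-1 * h)%g xpredT (fun h => sent st g (act h x0))).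
apply: ler_sum_subset => //.
- by rewrite map_inj_uniq//; exact: mulgI.
- by move=> _ /mapP[h hP ->]; apply: PQ => //; rewrite inE eqxx.
- by move=> h _; exact: sent_ge0.
Qed.

End Greedy.

(** * Exhaustion of mass over multiple scales *)

Section Covering.
Variables (G : groupType) (L : nat -> seq G).
Hypothesis L_uniq : forall n, uniq (L n).
Hypothesis L_mul : forall m n g h, g \in L m -> h \in L n -> (g * h)%g \in L (m + n)%N.
Hypothesis L_inv : forall n g, g \in L n -> (g^-1)%g \in L n.
Hypothesis L1 : forall n, 1%g \in L n.

(** Greedy selection: an element of [S] joins [T] unless it lies within [r + r] of one already
    chosen. So the balls of radius [r] around [T] are disjoint, and doubling the radius covers
    [S]. *)
Lemma vitali (r : nat) (S : seq G) : exists T : seq G,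
  [/\ {subset T <= S},
      uniq [seq (h * t)%g | t <- T, h <- L r] &
      {subset S <= [seq (h * t)%g | t <- T, h <- L (r + r)%N]}].
Proof.
suff [T [TS uT sep cov]] : exists T : seq G,
  [/\ {subset T <= S}, uniq T,
      {in T &, forall s t, (t * s^-1)%g \in L (r + r)%N -> s = t} &
      forall s, s \in S -> exists2 t, t \in T & (s * t^-1)%g \in L (r + r)%N].
  exists T; split=> //.
    apply: allpairs_uniq => // -[? ?] [? ?].
    move=> /allpairsP[[t1 h1] /= [t1T h1L [-> ->]]].
    move=> /allpairsP[[t2 h2] /= [t2T h2L [-> ->]]] e.
    have t12 : t1 = t2.
      apply: sep => //; have -> : (t2 * t1^-1 = h2^-1 * h1)%g.
        by apply: (mulgI h2); rewrite mulVKg mulgA -e mulgK.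
      exact/L_mul/h1L/L_inv.
    by move: e; rewrite t12 => /mulIg ->.
  move=> s /cov[t tT ts]; apply/allpairsP; exists (t, s * t^-1)%g; split=> //=.
  by rewrite mulgVK.
elim: S => [|s S [T [TS uT sep cov]]]; first by exists [::].
have [/hasP[t tT ts]|/hasPn far] := boolP (has (fun t => (s * t^-1)%g \in L (r + r)%N) T).
  exists T; split=> //; first by move=> x /TS xS; rewrite inE xS orbT.
  by move=> x; rewrite inE => /orP[/eqP->|/cov//]; exists t.
exists (s :: T); split.
- by move=> x; rewrite !inE => /orP[->//|/TS ->]; rewrite orbT.
- rewrite /= uT andbT; apply/negP => sT; move: (far _ sT).
  by rewrite mulgV L1.
- move=> x y; rewrite !inE => /orP[/eqP->|xT] /orP[/eqP->|yT]//; last exact: sep.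
  + by move=> /L_inv; rewrite invgM invgK => ys; have := far _ yT; rewrite ys.
  + by move=> ys; have := far _ xT; rewrite ys.
- move=> x; rewrite inE => /orP[/eqP->|/cov[t tT xt]].
    by exists s; rewrite ?inE ?eqxx// mulgV.
  by exists t => //; rewrite inE tT orbT.
Qed.

Variables (R : realType) (X : Type) (act : G -> X -> X).
Hypothesis act1 : forall x, act 1%g x = x.
Hypothesis actM : forall g h x, act (g * h)%g x = act g (act h x).
Hypothesis L_mono : forall m n, (m <= n)%N -> {subset L m <= L n}.

Variables (u v : X -> R) (r : nat -> nat) (eps K : R).
Hypothesis u0 : forall x, 0 <= u x.
Hypothesis u1 : forall x, u x <= 1.
Hypothesis v0 : forall x, 0 <= v x.
Hypothesis eps_gt0 : 0 < eps.
Hypothesis K_gt0 : 0 < K.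
Hypothesis r_double : forall j, ((r j).*2 <= r j.+1)%N.
Hypothesis r_folner : forall j,
  (size (L (r j.+1 + r j)))%:R <= (1 + eps / 2) * (size (L (r j.+1)))%:R.
Hypothesis r_doubling : forall j,
  (size (L (4 * r j.+1)))%:R <= K * (size (L (r j.+1)))%:R.
Hypothesis gap : forall j y,
  \sum_(h <- L (r j.+1)) u (act h y) + eps * (size (L (r j.+1)))%:R <=
  \sum_(h <- L (r j.+1)) v (act h y).

(** The first [j] stages use the radii [r 1], ..., [r j], so their moves stay in the ball of radius
    [r j]. *)
Definition stages j := flatten [seq L (r i.+1) | i <- iota 0 j].

Let state j := run act (u, v) (stages j).

Let uv0 : nonneg (u, v). Proof. by []. Qed.

Lemma stagesS j : stages j.+1 = stages j ++ L (r j.+1).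
Proof. by rewrite /stages -[X in iota 0 X]addn1 iotaD map_cat flatten_cat /= cats0 add0n. Qed.

Let stateS j : state j.+1 = run act (state j) (L (r j.+1)).
Proof. by rewrite /state stagesS run_cat. Qed.

Let state0 j : nonneg (state j).
Proof. exact: run_nonneg. Qed.

Let state_ge0 j x : 0 <= (state j).1 x.
Proof. by have [] := state0 j. Qed.

Lemma scale_mono i j : (i <= j)%N -> (r i <= r j)%N.
Proof.
elim: j => [|j IH]; first by rewrite leqn0 => /eqP->.
rewrite leq_eqVlt => /orP[/eqP->//|]; rewrite ltnS => /IH; have := r_double j; lia.
Qed.

Lemma stages_sub j : {subset stages j <= L (r j)}.
Proof.
move=> g /flatten_mapP[i]; rewrite mem_iota add0n => /andP[_ ij] gi.
exact: L_mono (scale_mono ij) _ gi.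
Qed.

(* A point still carrying mass after stage j+1 sees only exhausted targets in
its ball; the Følner condition bounds what the shorter moves of the earlier
stages can have brought into that ball, so stage j+1 itself brings in mass eps/2
per point. *)
Lemma stage_consumption j y : 0 < (state j.+1).1 y ->
  eps / 2 * (size (L (r j.+1)))%:R <=
  \sum_(h <- L (r j.+1)) ((state j).2 (act h y) - (state j.+1).2 (act h y)).
Proof.
move=> uy; set P := L (r j.+1); set Q := L (r j.+1 + r j)%N.
have -> : \sum_(h <- P) ((state j).2 (act h y) - (state j.+1).2 (act h y)) =
    \sum_(h <- P) v (act h y) - \sum_(h <- P) (v (act h y) - (state j).2 (act h y)).
  rewrite -sumrB big_seq [RHS]big_seq; apply: eq_bigr => h hP.
  have -> : (state j.+1).2 (act h y) = 0.
    by move: uy; rewrite stateS; apply: run_blocked.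
  ring.
have T : \sum_(h <- P) (v (act h y) - (state j).2 (act h y)) <=
         \sum_(h <- Q) (u (act h y) - (state j).1 (act h y)).
  apply: (run_transport act1 actM y uv0 (L_uniq _) (L_uniq _)) => g h /stages_sub gj hP.
  by rewrite /Q addnC; exact/L_mul/hP/L_inv.
have T2 : \sum_(h <- Q) (u (act h y) - (state j).1 (act h y)) <= \sum_(h <- Q) u (act h y).
  by apply: ler_sum => h _; rewrite gerBl state_ge0.
have T3 : \sum_(h <- Q) u (act h y) <=
    \sum_(h <- P) u (act h y) + ((size Q)%:R - (size P)%:R).
  by apply: (ler_sum_superset (L_uniq _) (L_uniq _)) => [|h]; [apply: L_mono; rewrite leq_addr|exact: u1].
have := gap j y; have := r_folner j; rewrite -/P -/Q; lra.
Qed.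

Let mass j rho x0 : R := \sum_(h <- L rho) (state j).1 (act h x0).

(* Balls of radius [r j.+1] around the points still carrying mass are thinned
out to disjoint ones; the mass they receive in stage j+1 is mass present before
that stage. *)
Lemma mass_growth j rho x0 :
  (1 + eps / (2 * K)) * mass j.+1 rho x0 <= mass j (rho + r j.+1 + r j.+1) x0.
Proof.
set rr := r j.+1; set S := [seq h <- L rho | 0 < (state j.+1).1 (act h x0)].
have [T [TS uT ST]] := vitali rr S.
set P := [seq _ | _ <- T, _ <- _] in uT; set Q := L (rho + rr + rr)%N.
have PQ h : h \in P -> h \in L (rho + rr)%N.
  move=> /allpairsP[[t g] /= [/TS]]; rewrite mem_filter => /andP[_ tr] gr ->.
  by rewrite addnC; exact: L_mul.
have trans : \sum_(h <- P) ((state j).2 (act h x0) - (state j.+1).2 (act h x0)) <=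
             \sum_(h <- Q) ((state j).1 (act h x0) - (state j.+1).1 (act h x0)).
  rewrite stateS; apply: (run_transport act1 actM x0 (state0 j) uT (L_uniq _)) => g h gr /PQ hP.
  by rewrite /Q addnC; exact/L_mul/hP/L_inv.
have cons : (size T)%:R * (eps / 2 * (size (L rr))%:R) <=
    \sum_(h <- P) ((state j).2 (act h x0) - (state j.+1).2 (act h x0)).
  rewrite big_allpairs_dep -sumr_const_seq.
  rewrite big_seq [leRHS]big_seq; apply: ler_sum => t /TS; rewrite mem_filter => /andP[ut _].
  under eq_bigr do rewrite !actM.
  exact: stage_consumption.
have coverS : (size S <= size T * size (L (rr + rr)%N))%N.
  by apply: leq_trans (uniq_leq_size (filter_uniq _ (L_uniq rho)) ST) _; rewrite size_allpairs.
have dbl : (size (L (rr + rr)%N))%:R <= K * (size (L rr))%:R.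
  apply: le_trans (r_doubling j); rewrite ler_nat uniq_leq_size//.
  by apply: L_mono; rewrite -/rr; lia.
have ST' : (size S)%:R <= (size T)%:R * (K * (size (L rr))%:R).
  apply: le_trans (_ : (size T)%:R * (size (L (rr + rr)%N))%:R <= _).
    by rewrite -natrM ler_nat.
  by rewrite ler_wpM2l.
have massS : mass j.+1 rho x0 <= (size S)%:R.
  rewrite /mass (bigID (fun h => 0 < (state j.+1).1 (act h x0))) /= -big_filter.
  rewrite [X in _ + X]big1 ?addr0; last first.
    by move=> h; rewrite -leNgt => uh; apply/le_anti; rewrite uh state_ge0.
  apply: ler_sum_size => h; apply: le_trans (u1 (act h x0)).
  by have [] := run_le act1 actM (stages j.+1) uv0.
have big : mass j.+1 rho x0 <= \sum_(h <- Q) (state j.+1).1 (act h x0).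
  apply: (ler_sum_subset (L_uniq _) (L_uniq _)).
    by apply: L_mono; rewrite /rr -addnA leq_addr.
  by move=> h _; rewrite state_ge0.
(* Each ball around a point of [T] receives at least [eps / 2] times the size of [L rr] and accounts
   for at most [K] times that size of points of [S]; the quotient is [eps / (2 * K)]. *)
have c1 : eps / (2 * K) * (size S)%:R <= (size T)%:R * (eps / 2 * (size (L rr))%:R).
  rewrite [leRHS](_ : _ = eps / (2 * K) * ((size T)%:R * (K * (size (L rr))%:R))).
    by rewrite ler_wpM2l// divr_ge0 ?mulr_ge0 ?ltW.
  by field; rewrite gt_eqF.
have c2 : eps / (2 * K) * mass j.+1 rho x0 <= eps / (2 * K) * (size S)%:R.
  by rewrite ler_wpM2l// divr_ge0 ?mulr_ge0 ?ltW.
rewrite [leRHS]sumrB in trans.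
rewrite mulrDl mul1r; apply: le_trans (lerD big (le_trans c2 (le_trans c1 (le_trans cons trans)))) _.
by rewrite addrC subrK.
Qed.

(** Iterates [mass_growth] down to stage 0. The successive enlargements by twice a radius add up to
    at most [4 * r j], because the radii at least double. *)
Let mass_le_mass0 j rho x0 :
  (1 + eps / (2 * K)) ^+ j * mass j rho x0 <= mass 0 (rho + 4 * r j) x0.
Proof.
have mass0_mono a b : (a <= b)%N -> mass 0 a x0 <= mass 0 b x0.
  by move=> ab; apply: (ler_sum_subset (L_uniq _) (L_uniq _)) => [|h _]; first exact: L_mono.
have c0 : 0 <= 1 + eps / (2 * K) by rewrite addr_ge0// divr_ge0 ?mulr_ge0 ?ltW.
elim: j rho => [|j IH] rho; first by rewrite mul1r mass0_mono// leq_addr.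
rewrite exprSr -mulrA.
apply: le_trans (_ : (1 + eps / (2 * K)) ^+ j * mass j (rho + r j.+1 + r j.+1) x0 <= _).
  by rewrite ler_wpM2l ?exprn_ge0// mass_growth.
by apply: le_trans (IH _) _; apply: mass0_mono; have := r_double j; lia.
Qed.

Lemma greedy_exhausts : exists J, forall x, (run act (u, v) (stages J)).1 x <= 0.
Proof.
(* The threshold is the quotient of the upper bound [K * b] and the lower bound [eps / 2 * b]
   obtained below. *)
have [j jK] := @expr_unbounded R (eps / (2 * K)) (2 * K / eps)
  (divr_gt0 eps_gt0 (mulr_gt0 (ltr0Sn _ 1) K_gt0)).
exists j.+1 => x; rewrite leNgt; apply/negP => ux.
set b : R := (size (L (r j.+1)))%:R.
have b_gt0 : 0 < b by rewrite ltr0n; case: (L (r j.+1)) (L1 (r j.+1)).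
have base : eps / 2 * b <= mass j (r j.+1 + r j.+1) x.
  apply: le_trans (stage_consumption ux) _.
  apply: le_trans (_ : \sum_(h <- L (r j.+1 + r j.+1))
     ((state j).1 (act h x) - (state j.+1).1 (act h x)) <= _).
    rewrite stateS; apply: (run_transport act1 actM x (state0 j) (L_uniq _) (L_uniq _)) => g h gr hr.
    exact/L_mul/hr/L_inv.
  by apply: ler_sum => h _; rewrite gerBl state_ge0.
have top : mass 0 (r j.+1 + r j.+1 + 4 * r j) x <= K * b.
  apply: le_trans (r_doubling j); apply: le_trans (_ : mass 0 (4 * r j.+1) x <= _).
    apply: (ler_sum_subset (L_uniq _) (L_uniq _)) => [|h _]; last exact: state_ge0.
    by apply: L_mono; have := r_double j; lia.
  by apply: ler_sum_size => h; exact: u1.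
have := le_trans (mass_le_mass0 j (r j.+1 + r j.+1) x) top; rewrite leNgt => /negP; apply.
have -> : K * b = (2 * K / eps) * (eps / 2 * b) by field; rewrite gt_eqF.
apply: lt_le_trans (_ : (1 + eps / (2 * K)) ^+ j * (eps / 2 * b) <= _).
  by rewrite ltr_pM2r// mulr_gt0// divr_gt0.
by rewrite ler_wpM2l// exprn_ge0// addr_ge0// divr_ge0 ?mulr_ge0 ?ltW.
Qed.

End Covering.

(** * From transport to subequivalence *)

Section Rounding.
Variables (R : realType) (G : groupType) (X : ptopologicalType) (act : G -> X -> X).
Hypothesis act1 : forall x, act 1%g x = x.
Hypothesis actM : forall g h x, act (g * h)%g x = act g (act h x).
Hypothesis act_cont : forall g, continuous (act g).

Lemma step_continuous (st : (X -> R) * (X -> R)) g :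
  continuous st.1 -> continuous st.2 ->
  continuous (step act st g).1 /\ continuous (step act st g).2.
Proof.
move=> cu cv; have cs : continuous (sent act st g).
  move=> x; apply: (@continuous_min _ _ st.1 (st.2 \o act g)); first exact: cu.
  by apply: continuous_comp; [exact: act_cont|exact: cv].
split=> x; apply: cvgB; [exact: cu|exact: cs|exact: cv|].
by apply: (@continuous_comp _ _ _ (act g^-1%g)); [exact: act_cont|exact: cs].
Qed.

Lemma run_continuous (st : (X -> R) * (X -> R)) gs :
  continuous st.1 -> continuous st.2 ->
  continuous (run act st gs).1 /\ continuous (run act st gs).2.
Proof. by elim: gs st => [|g gs IH] st c1 c2 //=; have [] := step_continuous g c1 c2; exact: IH. Qed.

Lemma open_ltr_fun (f g : X -> R) : continuous f -> continuous g -> open [set x | f x < g x].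
Proof.
move=> cf cg; rewrite (_ : [set x | _] = (fun x => g x - f x) @^-1` [set y | 0 < y]).
  apply: open_comp; last exact: open_gt.
  by move=> x _; apply: cvgB; [exact: cg|exact: cf].
by apply/seteqP; split=> x /=; rewrite subr_gt0.
Qed.

(* A target chooses the source that exhausts it, provided that this source has
mass to spare; this is an open condition. The first move of a source of mass 1
always exhausts its target, because targets have capacity less than 1. *)
Lemma exhausting_subequivalent (u v : X -> R) (gs : seq G) (A B : set X) :
  continuous u -> continuous v ->
  (forall x, 0 <= u x) -> (forall x, 0 <= v x) -> (forall x, v x < 1) ->
  (forall x, 0 < v x -> B x) ->
  (forall x, A x -> u x = 1 /\ (run act (u, v) gs).1 x < 1) ->
  exists (n : nat) (U : nat -> set X) (s : nat -> G),
    (forall i, (i < n)%N -> open (U i)) /\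
    A `<=` \bigcup_(i in `I_n) U i /\
    (forall i j, (i < n)%N -> (j < n)%N -> i <> j ->
       act (s i) @` U i `&` act (s j) @` U j = set0) /\
    (forall i, (i < n)%N -> act (s i) @` U i `<=` B).
Proof.
move=> cu cv u0 v0 v1 vB uA.
pose s i := nth 1%g gs i; pose st i := run act (u, v) (take i gs).
have stS i : (i < size gs)%N -> st i.+1 = step act (st i) (s i).
  by move=> ilt; rewrite /st (take_nth 1%g)// -cats1 run_cat.
have st0 i : nonneg (st i) by exact: run_nonneg.
have st_mono i j : (i <= j)%N -> (forall x, (st j).1 x <= (st i).1 x) /\
    (forall x, (st j).2 x <= (st i).2 x).
  move=> ij; have -> : st j = run act (st i) (drop i (take j gs)).
    by rewrite -run_cat -[in RHS](take_takel gs ij) cat_take_drop.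
  exact: run_le.
pose U i := [set x | 0 < (st i).2 (act (s i) x)] `&`
            [set x | (st i).2 (act (s i) x) < (st i).1 x].
have used i x : (i < size gs)%N -> U i x -> (st i.+1).2 (act (s i) x) = 0.
  move=> ilt [_ /= lt2]; rewrite stS//= (actKV act1 actM) /sent.
  by rewrite (min_idPr (ltW lt2)) subrr.
(* A target exhausted by the move [i] has no capacity left at any later move [j]. *)
have disj i j x y : (i < j)%N -> (j < size gs)%N -> U i x -> U j y ->
    act (s i) x = act (s j) y -> False.
  move=> ij jlt Ux [/= + _] e; rewrite -e ltNge => /negP; apply.
  rewrite -(used i x (ltn_trans ij jlt) Ux).
  by have [_] := st_mono i.+1 j ij; apply.
exists (size gs), U, s; split; [|split; [|split]].
- move=> i ilt; have [c1 c2] := @run_continuous (u, v) (take i gs) cu cv.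
  have c2s : continuous ((st i).2 \o act (s i)).
    by move=> x; apply: continuous_comp; [exact: act_cont|exact: c2].
  by apply: openI; apply: open_ltr_fun => //; exact: cst_continuous.
- move=> x /uA[ux1 ux]; apply: contrapT => noU.
  (* A point of mass 1 outside every [U i] meets only empty targets, so it would keep its full mass
     to the end. *)
  suff H i : (i <= size gs)%N -> (st i).1 x = 1.
    by move: ux; have := H _ (leqnn _); rewrite /st take_size => ->; rewrite ltxx.
  elim: i => [|i IH] ilt; first by rewrite /st take0.
  have v1i : (st i).2 (act (s i) x) < 1.
    by apply: le_lt_trans (v1 (act (s i) x)); have [_] := st_mono 0%N i (leq0n i); rewrite /st take0; apply.
  rewrite stS//= /sent (IH (ltnW ilt)) (min_idPr (ltW v1i)).
  suff -> : (st i).2 (act (s i) x) = 0 by rewrite subr0.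
  apply/eqP; rewrite eq_le; have [_ ->] := st0 i; rewrite andbT leNgt.
  apply/negP => vpos; apply: noU; exists i => //; split=> //=.
  by rewrite (IH (ltnW ilt)).
- move=> i j ilt jlt /eqP ij; rewrite -subset0 => z [[x Ux <-] [y Uy /esym e]].
  by move: ij; rewrite neq_ltn => /orP[] ij; [exact: (disj i j x y)|exact: (disj j i y x)].
- move=> i ilt _ [x [/= vpos _] <-]; apply: vB; apply: lt_le_trans vpos _.
  by have [_] := st_mono 0%N i (leq0n i); rewrite /st take0; apply.
Qed.

End Rounding.

(** * Regular measures from finitely additive means *)

Section RegularMeasure.
Variables (R : realType) (X : ptopologicalType) (m : set X -> R).
Hypothesis X_compact : compact [set: X].
Hypothesis X_normal : normal_space X.
Hypothesis m_ge0 : forall A, 0 <= m A.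
Hypothesis mT : m [set: X] = 1.
Hypothesis mU : forall A B, A `&` B = set0 -> m (A `|` B) = m A + m B.
Local Open Scope ereal_scope.

Lemma mean0 : m set0 = 0%R.
Proof. by have := mU (setI0 set0); rewrite setU0; lra. Qed.

Lemma mean_mono (A B : set X) : A `<=` B -> (m A <= m B)%R.
Proof.
move=> AB; by rewrite -(setDUK AB) mU ?lerDl// setDIK.
Qed.

Lemma mean_setU (A B : set X) : (m (A `|` B) <= m A + m B)%R.
Proof.
have -> : A `|` B = A `|` (B `\` A) by rewrite setDE setUIr setUCr setIT.
rewrite mU ?setDIK// lerD2l.
by apply: mean_mono; exact: subDsetl.
Qed.

(** The passage from a content to a regular Borel measure: open sets are approximated by closed sets
    from inside, then arbitrary sets by open sets from outside. Only the values of [m] on closed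
    sets enter. *)
Definition inner_content (U : set X) : \bar R :=
  ereal_sup [set (m K)%:E | K in [set K | closed K /\ K `<=` U]].

Definition regular_outer (E : set X) : \bar R :=
  ereal_inf [set inner_content U | U in [set U | open U /\ E `<=` U]].

Lemma inner_content_ge (K U : set X) : closed K -> K `<=` U -> (m K)%:E <= inner_content U.
Proof. by move=> cK KU; apply: ereal_sup_ubound; exists K. Qed.

Lemma inner_content_le (U : set X) (c : \bar R) :
  (forall K, closed K -> K `<=` U -> (m K)%:E <= c) -> inner_content U <= c.
Proof. by move=> H; apply: ge_ereal_sup => _ [K [cK KU] <-]; exact: H. Qed.

Lemma inner_content_mono (U V : set X) : U `<=` V -> inner_content U <= inner_content V.
Proof.
by move=> UV; apply: inner_content_le => K cK KU; apply: inner_content_ge => //; exact: subset_trans UV.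
Qed.

Lemma inner_content_ge0 (U : set X) : 0 <= inner_content U.
Proof.
have <- : (m set0)%:E = 0 by rewrite mean0.
by apply: inner_content_ge => //; exact: closed0.
Qed.

Lemma inner_content_le1 (U : set X) : inner_content U <= 1.
Proof.
apply: inner_content_le => K _ _; have <- : (m setT)%:E = 1 :> \bar R by rewrite mT.
by rewrite lee_fin mean_mono.
Qed.

Lemma inner_contentT : inner_content setT = 1.
Proof.
apply/eqP; rewrite eq_le inner_content_le1 /=.
have <- : (m setT)%:E = 1 :> \bar R by rewrite mT.
by apply: inner_content_ge => //; exact: closedT.
Qed.

Lemma regular_outer_le (E U : set X) : open U -> E `<=` U -> regular_outer E <= inner_content U.
Proof. by move=> oU EU; apply: ereal_inf_lbound; exists U. Qed.

Lemma regular_outer_ge (E : set X) c :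
  (forall U, open U -> E `<=` U -> c <= inner_content U) -> c <= regular_outer E.
Proof. by move=> H; apply: le_ereal_inf_tmp => _ [U [oU EU] <-]; exact: H. Qed.

Lemma regular_outer_open (U : set X) : open U -> regular_outer U = inner_content U.
Proof.
move=> oU; apply/eqP; rewrite eq_le regular_outer_le//=.
by apply: regular_outer_ge => V _; exact: inner_content_mono.
Qed.

Lemma regular_outer_ge0 (E : set X) : 0 <= regular_outer E.
Proof. by apply: regular_outer_ge => U _ _; exact: inner_content_ge0. Qed.

Lemma regular_outer_fin (E : set X) : regular_outer E \is a fin_num.
Proof.
rewrite ge0_fin_numE ?regular_outer_ge0//.
apply: le_lt_trans (regular_outer_le openT (@subsetT _ E)) _.
by rewrite inner_contentT ltry.
Qed.

Lemma regular_outer0 : regular_outer set0 = 0.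
Proof.
rewrite regular_outer_open; last exact: open0.
apply/eqP; rewrite eq_le inner_content_ge0 andbT.
by apply: inner_content_le => K _; rewrite subset0 => ->; rewrite mean0.
Qed.

Lemma regular_outer_mono : {homo regular_outer : A B / A `<=` B >-> A <= B}.
Proof.
move=> A B AB; apply: regular_outer_ge => U oU BU; apply: regular_outer_le => //.
exact: subset_trans BU.
Qed.

(** The closed sets [K \ U] and [K \ V] are disjoint; normality separates them by disjoint open
    sets, which are then removed from [K]. *)
Lemma closed_shrinking (K U V : set X) : closed K -> open U -> open V -> K `<=` U `|` V ->
  exists K1 K2, [/\ closed K1, closed K2, K1 `<=` U, K2 `<=` V & K = K1 `|` K2].
Proof.
move=> cK oU oV KUV.
have cKU : closed (K `\` U) by rewrite setDE; apply: closedI => //; rewrite closedC.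
have cKV : closed (K `\` V) by rewrite setDE; apply: closedI => //; rewrite closedC.
have dis : (K `\` U) `&` (K `\` V) = set0.
  by rewrite -subset0 => x [[Kx nU] [_ nV]]; case: (KUV x Kx).
have [P [Q [oP oQ KUP KVQ PQ]]] := (@normal_openP R X).1 X_normal _ _ cKU cKV dis.
exists (K `\` P), (K `\` Q); split.
- by rewrite setDE; apply: closedI => //; rewrite closedC.
- by rewrite setDE; apply: closedI => //; rewrite closedC.
- by move=> x [Kx nP]; apply: contrapT => nU; apply: nP; exact: KUP.
- by move=> x [Kx nQ]; apply: contrapT => nV; apply: nQ; exact: KVQ.
- rewrite -setDIr PQ setD0 //.
Qed.

Lemma mean_le_sum (U : nat -> set X) n (K : set X) : (forall i, open (U i)) -> closed K ->
  K `<=` \bigcup_(i in `I_n) U i -> (m K)%:E <= \sum_(0 <= i < n) inner_content (U i).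
Proof.
move=> oU; elim: n K => [|n IH] K cK.
  by rewrite bigcup_mkord big_ord0 subset0 => ->; rewrite big_geq// mean0.
rewrite bigcup_mkord big_ord_recr /= -bigcup_mkord => KU.
have [K1 [K2 [cK1 cK2 K1U K2U ->]]] :=
  closed_shrinking cK (bigcup_open (fun i _ => oU i)) (oU n) KU.
rewrite big_nat_recr//=; apply: le_trans (_ : (m K1)%:E + (m K2)%:E <= _).
  by rewrite -EFinD lee_fin mean_setU.
by rewrite leeD ?IH// inner_content_ge.
Qed.

(** By compactness a closed subset of the union is covered by finitely many [U i], where
    [mean_le_sum] applies. *)
Lemma inner_content_sigma_subadditive (U : nat -> set X) : (forall i, open (U i)) ->
  inner_content (\bigcup_i U i) <= \sum_(i <oo) inner_content (U i).
Proof.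
move=> oU; apply: inner_content_le => K cK KU.
have cpK : compact K by apply: subclosed_compact X_compact _.
have := cpK; rewrite compact_cover => /(_ nat setT U (fun i _ => oU i) KU) [D _ KD].
pose n := (\max_(i <- finmap.enum_fset D) i).+1.
apply: le_trans (nneseries_lim_ge n (fun i _ _ => inner_content_ge0 (U i))).
apply: mean_le_sum => // x /KD[i iD Uix]; exists i => //=.
by rewrite /n ltnS; exact: (@leq_bigmax_seq _ (finmap.enum_fset D) xpredT (fun i => i) i iD isT).
Qed.

Lemma regular_outer_sigma_subadditive : sigma_subadditive regular_outer.
Proof.
move=> F; apply/lee_addgt0Pr => e e0.
apply: le_trans (epsilon_trick _ (fun n => regular_outer_ge0 (F n)) (ltW e0)).
have adh n : exists U, [/\ open U, F n `<=` U &
    inner_content U <= regular_outer (F n) + (e / (2 ^ n.+1)%:R)%:E].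
  have e2 : (0 < e / (2 ^ n.+1)%:R)%R by rewrite divr_gt0// ltr0n expn_gt0.
  have [_ [U [oU FU] <-] /ltW ?] := lb_ereal_inf_adherent e2 (regular_outer_fin (F n)).
  by exists U.
have {adh}[U HU] := choice adh.
apply: le_trans (_ : inner_content (\bigcup_i U i) <= _).
  apply: regular_outer_le; first by apply: bigcup_open => i _; case: (HU i).
  by apply: subset_bigcup => i _; case: (HU i).
apply: le_trans (inner_content_sigma_subadditive _) _; first by move=> i; case: (HU i).
by apply: lee_nneseries => [i _ _|i _]; [exact: inner_content_ge0|case: (HU i)].
Qed.

HB.instance Definition _ := isOuterMeasure.Build R X regular_outer
  regular_outer0 regular_outer_ge0 regular_outer_mono regular_outer_sigma_subadditive.

(** Inside an open [W] containing [E], take a closed [K] in [W] and [U], then a closed [L] in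
    [W \ K]. They are disjoint, so [m K + m L] is at most the content of [W]; the suprema over [L]
    and [K] give the inequality. *)
Lemma open_caratheodory (U : set X) : open U -> regular_outer.-caratheodory U.
Proof.
move=> oU; apply: le_caratheodory_measurable => E.
apply: regular_outer_ge => W oW EW.
apply: le_trans (_ : inner_content (W `&` U) + regular_outer (E `&` ~` U) <= _).
  by apply: leeD => //; apply: regular_outer_le; [exact: openI|exact: setSI].
rewrite -leeBrDr ?regular_outer_fin//; apply: inner_content_le => K cK KWU.
rewrite leeBrDr ?regular_outer_fin// -leeBrDl//.
apply: le_trans (_ : inner_content (W `\` K) <= _).
  apply: regular_outer_le; first by rewrite setDE; apply: openI => //; rewrite openC.
  by move=> x [/EW Wx nUx]; split=> // /KWU[].
apply: inner_content_le => L cL LWK; rewrite leeBrDl// -EFinD -mU; last first.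
  by rewrite -subset0 => x [Kx /LWK[]].
apply: inner_content_ge; first exact: closedU.
by move=> x [/KWU[]|/LWK[]].
Qed.

Definition regular_measure : set (g_sigma_algebraType (@open X)) -> \bar R := regular_outer.

Lemma borel_caratheodory (A : set (g_sigma_algebraType (@open X))) :
  measurable A -> regular_outer.-caratheodory A.
Proof.
apply: smallest_sub; last exact: open_caratheodory.
split; first exact: caratheodory_measurable_set0.
- by move=> B mB; rewrite setTD; exact: caratheodory_measurable_setC.
- by move=> F mF; exact: caratheodory_measurable_bigcup.
Qed.

Lemma regular_measure_sigma_additive : semi_sigma_additive regular_measure.
Proof.
move=> F mF tF _; apply: caratheodory_measure_sigma_additive => //.
  by move=> i; exact: borel_caratheodory.
by apply: caratheodory_measurable_bigcup => i; exact: borel_caratheodory.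
Qed.

HB.instance Definition _ := isMeasure.Build _ _ R regular_measure
  regular_outer0 regular_outer_ge0 regular_measure_sigma_additive.

Lemma regular_measureT : regular_measure setT = 1.
Proof. by rewrite /regular_measure regular_outer_open ?inner_contentT//; exact: openT. Qed.

HB.instance Definition _ := Measure_isProbability.Build _ _ R regular_measure regular_measureT.

Lemma regular_outer_preimage_le (f g : X -> X) (E : set X) :
  continuous f -> continuous g -> cancel f g -> cancel g f ->
  (forall A, m (f @^-1` A) = m A) -> (forall A, m (g @^-1` A) = m A) ->
  regular_outer (f @^-1` E) <= regular_outer E.
Proof.
move=> cf cg fg gf mf mg; apply: regular_outer_ge => U oU EU.
apply: le_trans (_ : inner_content (f @^-1` U) <= _).
  apply: regular_outer_le; last exact: preimage_subset.
  by apply: open_comp => // x _; exact: cf.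
apply: inner_content_le => K cK KU; rewrite -(mg K); apply: inner_content_ge.
  by apply: closed_comp => // x _; exact: cg.
by move=> x /= /KU /=; rewrite gf.
Qed.

(** The measure may differ from [m]; the last two clauses let inequalities for [m] on closed sets
    pass to the measure on open sets. *)
Lemma invariant_mean_measure (G : groupType) (act : G -> X -> X) :
  continuous_action act -> (forall g A, m (act g @^-1` A) = m A) ->
  exists mu : probability (g_sigma_algebraType (@open X)) R,
    [/\ invariant_measure act mu,
        forall K U, closed K -> open U -> K `<=` U -> (m K)%:E <= mu U &
        forall U c, open U -> (forall K, closed K -> K `<=` U -> (m K <= c)%R) ->
          mu U <= c%:E].
Proof.
move=> [act1 [actM act_cont]] mg.
have actgV g : cancel (act g) (act g^-1%g) by move=> x; rewrite -actM mulVg.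
have actVg g : cancel (act g^-1%g) (act g) by move=> x; rewrite -actM mulgV.
exists (regular_measure : probability _ _); split.
- move=> g A _; apply/eqP; rewrite eq_le; apply/andP; split.
    exact: (regular_outer_preimage_le _ (act_cont g) (act_cont g^-1%g)).
  rewrite -[A in leLHS](_ : act g^-1%g @^-1` (act g @^-1` A) = A).
    exact: (regular_outer_preimage_le _ (act_cont g^-1%g) (act_cont g)).
  by apply/seteqP; split=> x /=; rewrite actVg.
- move=> K U cK oU KU; rewrite /= /regular_measure regular_outer_open//.
  exact: inner_content_ge.
- move=> U c oU H; rewrite /= /regular_measure regular_outer_open//.
  by apply: inner_content_le => K cK KU; rewrite lee_fin H.
Qed.

End RegularMeasure.

(** * Word balls and polynomial growth *)

Section Balls.
Variables (G : groupType) (S : seq G).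
Hypothesis S_sym : symmetric_set S.

Lemma word_ball_mono m n : (m <= n)%N -> word_ball S m `<=` word_ball S n.
Proof. by move=> mn g [w [wm H]]; exists w; split=> //; exact: leq_trans mn. Qed.

Lemma word_ball1 n : word_ball S n 1%g.
Proof. by exists [::]; split. Qed.

Lemma word_prod_cat (w z : seq G) : word_prod (w ++ z) = (word_prod w * word_prod z)%g.
Proof. by elim: w => [|a w IH] /=; rewrite ?mul1g// IH mulgA. Qed.

Lemma word_ballM m n g h : word_ball S m g -> word_ball S n h -> word_ball S (m + n) (g * h)%g.
Proof.
move=> [w [wm [wS ->]]] [z [zn [zS ->]]]; exists (w ++ z); split.
  by rewrite size_cat leq_add.
split; last by rewrite word_prod_cat.
by move=> a /List.in_app_iff[/wS|/zS].
Qed.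

Lemma word_ballV n g : word_ball S n g -> word_ball S n g^-1%g.
Proof.
move=> [w [wn [wS ->]]] {g}; elim: w n wn wS => [|a w IH] n /= wn wS.
  by rewrite invg1; exact: word_ball1.
case: n wn => // n wn; rewrite invgM -addn1; apply: word_ballM.
  by apply: IH => // b bw; apply: wS; right.
exists [:: a^-1%g]; split=> //; split; last by rewrite /= mulg1.
by move=> b [<-|[]]; apply: S_sym; apply: wS; left.
Qed.

Lemma word_ball_enum (C d : nat) :
  (forall n, (1 <= n)%N -> (word_ball S n #<= `I_(C * n ^ d))%card) ->
  exists L : nat -> seq G, [/\ forall n, uniq (L n),
    forall n g, g \in L n <-> word_ball S n g &
    forall n, (1 <= n)%N -> (size (L n) <= C * n ^ d)%N].
Proof.
move=> growth.
(* Passing to radius [n + 1] covers radius 0, where the growth bound is not assumed. *)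
have ball_fin n : finite_set (word_ball S n).
  apply: sub_finite_set (word_ball_mono (leq_addr 1 n)) _.
  by apply: card_le_finite (growth _ _) _; rewrite ?addn1.
exists (fun n => finmap.enum_fset (fset_set (word_ball S n))).
split=> [n|n g|n n1]; first exact: finmap.fset_uniq.
  by rewrite (in_fset_set (ball_fin n)) inE.
have /card_eq_fsetP/card_esym := erefl (size (finmap.enum_fset (fset_set (word_ball S n)))).
rewrite (fset_setK (ball_fin n)) -card_le_II => e.
by rewrite (card_le_eql e); exact: growth.
Qed.
End Balls.

(** * Scales that are both Følner and doubling *)

Section Scales.
Variables (R : realType) (b : nat -> nat) (C d : nat).
Hypothesis b_gt0 : forall n, (0 < b n)%N.
Hypothesis b_mono : forall m n, (m <= n)%N -> (b m <= b n)%N.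
Hypothesis b_growth : forall n, (1 <= n)%N -> (b n <= C * n ^ d)%N.

(** Otherwise [b (8 ^ i * n1)] grows at least like [8 ^ (d.+1 * i)], faster than the bound of degree
    [d] in [8 ^ i]. *)
Lemma doubling_scale n0 : exists n, (n0 <= n)%N /\ (b (8 * n) <= 8 ^ d.+1 * b n)%N.
Proof.
apply: contrapT => H.
have step n : (n0 <= n)%N -> (8 ^ d.+1 * b n < b (8 * n))%N.
  by move=> nn; rewrite ltnNge; apply/negP => le; apply: H; exists n.
pose n1 := n0.+1; have n0i i : (n0 <= 8 ^ i * n1)%N.
  by rewrite (leq_trans (leqnSn n0))// leq_pmull// expn_gt0.
have iter i : ((8 ^ d.+1) ^ i <= b (8 ^ i * n1))%N.
  elim: i => [|i IH]; first by rewrite !expn0.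
  rewrite [((8 ^ d.+1) ^ i.+1)%N]expnS [(8 ^ i.+1)%N]expnS -mulnA.
  by apply: leq_trans (ltnW (step _ (n0i i))); rewrite leq_mul.
(* With this [i], the constant [C * n1 ^ d] is less than [8 ^ i]. *)
pose i := (C * n1 ^ d)%N.
have : (b (8 ^ i * n1) <= C * (8 ^ i * n1) ^ d)%N by rewrite b_growth// muln_gt0 expn_gt0.
move=> /(leq_trans (iter i)); rewrite leqNgt => /negP; apply.
have -> : ((8 ^ d.+1) ^ i = (8 ^ i) ^ d * 8 ^ i)%N by rewrite -!expnM -expnD; congr expn; lia.
rewrite expnMn mulnCA ltn_pmul2l ?expn_gt0//.
exact: ltn_expl.
Qed.

(** From a large doubling scale [n], try the radii [n + i * s] for [i < M]. If each step multiplied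
    the size by more than [1 + eta], the total would exceed the factor [8 ^ d.+1]. All these radii
    are at most [2 * n], so doubling survives with [4 * r] in place of [8 * n]. *)
Lemma folner_doubling_scale n0 s (eta : R) : 0 < eta -> exists r, [/\ (n0 <= r)%N,
  (b (r + s)%N)%:R <= (1 + eta) * (b r)%:R & (b (4 * r)%N <= 8 ^ d.+1 * b r)%N].
Proof.
move=> eta0; have [M HM] := @expr_unbounded R eta (8 ^ d.+1)%:R eta0.
have [n [nn bn]] := doubling_scale (n0 + M * s)%N.
have [i [iM Hi]] : exists i, (i < M)%N /\ (b (n + i * s + s)%N)%:R <= (1 + eta) * (b (n + i * s)%N)%:R.
  apply: contrapT => H.
  have grow i : (i <= M)%N -> (1 + eta) ^+ i * (b n)%:R <= (b (n + i * s)%N)%:R :> R.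
    elim: i => [|i IH] iM; first by rewrite mul1r mul0n addn0.
    have step : (1 + eta) * (b (n + i * s)%N)%:R < (b (n + i.+1 * s)%N)%:R.
      rewrite ltNge; apply/negP => le; apply: H; exists i; split=> //.
      by move: le; rewrite mulSn (addnC s) addnA.
    apply: le_trans (ltW step); rewrite exprS -mulrA ler_wpM2l ?IH 1?ltnW//.
    by rewrite addr_ge0// ltW.
  have := le_trans (grow M (leqnn _)) (_ : _ <= (8 ^ d.+1)%:R * (b n)%:R).
  rewrite -natrM ler_nat => /(_ (leq_trans (b_mono _) bn)) => /(_ _) .
  rewrite natrM ler_pM2r ?ltr0n// leNgt HM => H'; suff : false by [].
  by apply: H'; lia.
exists (n + i * s)%N; split=> //; first by lia.
have le2 : (n + i * s <= 2 * n)%N by have : (i * s <= M * s)%N by [rewrite leq_mul2r ltnW ?orbT]; lia.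
apply: leq_trans (b_mono (_ : _ <= 8 * n)%N) _; first by lia.
by apply: leq_trans bn _; rewrite leq_mul2l b_mono ?leq_addr ?orbT.
Qed.
End Scales.

(** * Density gap *)

Section UltraLimit.
Variables (R : realType) (I : Type) (U : set_system I) (UF : UltraFilter U).

Definition ulim (f : I -> R) (l : R) := forall e, 0 < e -> U [set p | `|f p - l| < e].

(** Compactness of the unit interval gives a cluster point, and for an ultrafilter a cluster point
    is a limit. *)
Lemma ulim_exists (f : I -> R) : (forall p, 0 <= f p <= 1) -> exists l, ulim f l.
Proof.
move=> f01; have PU : ProperFilter U by exact: ultra_proper.
have fU : U (f @^-1` `[0, 1]%classic).
  by apply: filterS filterT => p _; rewrite /= in_itv /= f01.
have [l [_ cl]] := @segment_compact R 0 1 (f @ U) _ fU.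
exists l => e e0; have [//|nU] := in_ultra_setVsetC [set p | `|f p - l| < e] UF.
have [y [/= nyl yl]] := cl [set y | ~ (`|y - l| < e)] (ball l e) nU (nbhsx_ballx l e e0).
by case: nyl; rewrite distrC.
Qed.

Lemma ulim_le (f g : I -> R) a b : ulim f a -> ulim g b ->
  (forall e, 0 < e -> U [set p | f p <= g p + e]) -> a <= b.
Proof.
move=> fa gb fg; rewrite leNgt; apply/negP => ba.
have e0 : 0 < (a - b) / 4 by rewrite divr_gt0 ?subr_gt0.
have PU : ProperFilter U by exact: ultra_proper.
have [p [/= [p1 p2] p3]] := filter_ex (filterI (filterI (fa _ e0) (gb _ e0)) (fg _ e0)).
move: p1 p2; rewrite !ltr_distl => /andP[p11 p12] /andP[p21 p22]; lra.
Qed.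

Lemma ulimD (f g : I -> R) a b : ulim f a -> ulim g b -> ulim (fun p => f p + g p) (a + b).
Proof.
move=> fa gb e e0; have e2 : 0 < e / 2 by rewrite divr_gt0.
have PU : ProperFilter U by exact: ultra_proper.
apply: filterS (filterI (fa _ e2) (gb _ e2)) => p [/= p1 p2].
have := ler_normD (f p - a) (g p - b); rewrite addrACA -opprD; lra.
Qed.

Lemma ulim_cst (a : R) : ulim (fun=> a) a.
Proof.
have PU : ProperFilter U by exact: ultra_proper.
by move=> e e0; apply: filterS filterT => p _ /=; rewrite subrr normr0.
Qed.

Lemma ulim_unique (f : I -> R) a b : ulim f a -> ulim f b -> a = b.
Proof.
have PU : ProperFilter U by exact: ultra_proper.
move=> fa fb; have le e : 0 < e -> U [set p | f p <= f p + e].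
  by move=> e0; apply: filterS filterT => p _ /=; rewrite lerDl ltW.
by apply/le_anti/andP; split; [exact: ulim_le fa fb le|exact: ulim_le fb fa le].
Qed.
End UltraLimit.

(** * Separation and bump functions *)

Lemma metrizable_hausdorff (R : realType) (X : ptopologicalType) :
  metrizable X R -> hausdorff_space X.
Proof.
move=> [d [d0 [dE [dC [dT dO]]]]].
have ball_open x e : open [set y | d x y < e].
  apply/dO => y /= xy; exists (e - d x y); first by rewrite subr_gt0.
  by move=> z /=; have := dT x y z; lra.
rewrite open_hausdorff => x y xy.
have e0 : 0 < d x y / 2.
  rewrite divr_gt0// lt_neqAle d0 andbT eq_sym; apply/eqP => /dE e.
  by move: xy; rewrite e eqxx.
exists ([set z | d x z < d x y / 2], [set z | d y z < d x y / 2]) => /=.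
  by split; rewrite inE /=; [rewrite (_ : d x x = 0)|rewrite (_ : d y y = 0)] => //; apply/dE.
split=> //; apply/eqP; rewrite -subset0 => z [/= xz yz].
by have := dT x z y; rewrite (dC z y); lra.
Qed.

Lemma bump_function (R : realType) (X : ptopologicalType) (K U : set X) :
  normal_space X -> closed K -> open U -> K `<=` U ->
  exists f : X -> R, [/\ continuous f, forall x, 0 <= f x <= 1,
    forall x, K x -> f x = 1 & forall x, ~ U x -> f x = 0].
Proof.
move=> nX cK oU KU.
have sep : uniform_separator (~` U) K.
  apply: normal_uniform_separator => //; first by rewrite closedC.
  by rewrite -subset0 => x [nU /KU].
exists (Urysohn (~` U) K); split.
- exact: Urysohn_continuous.
- move=> x; have : `[0%R, 1%R]%classic (Urysohn (~` U) K x : R).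
    by apply: Urysohn_range; exists x.
  by rewrite /= in_itv.
- by move=> x Kx; apply: (Urysohn_sub1 sep); exists x.
- by move=> x nUx; apply: (Urysohn_sub0 sep); exists x.
Qed.

(** * Visit frequencies and the gap between mass and capacity *)

Section DensityGap.
Variables (R : realType) (G : groupType) (X : ptopologicalType) (act : G -> X -> X).
Hypothesis X_compact : compact [set: X].
Hypothesis X_normal : normal_space X.
Hypothesis act_action : continuous_action act.
Variable L : nat -> seq G.
Hypothesis L_uniq : forall n, uniq (L n).
Hypothesis L_mul : forall m n g h, g \in L m -> h \in L n -> (g * h)%g \in L (m + n)%N.
Hypothesis L1 : forall n, 1%g \in L n.
Hypothesis L_mono : forall m n, (m <= n)%N -> {subset L m <= L n}.
Hypothesis L_gen : forall g, exists n, g \in L n.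

Let b n : R := (size (L n))%:R.

Let b_gt0 n : 0 < b n.
Proof. by rewrite ltr0n; case: (L n) (L1 n). Qed.

Let actM g h x : act (g * h)%g x = act g (act h x).
Proof. by have [_ []] := act_action. Qed.

Definition visits (r : nat) (y : X) (E : set X) : R :=
  (\sum_(h <- L r) (`[< E (act h y) >])%:R) / (size (L r))%:R.

Let nat_bool01 (P : Prop) : 0 <= ((`[< P >])%:R : R) <= 1.
Proof. by case: asboolP => _; rewrite ?ler01 ?lexx. Qed.

Lemma visits01 r y E : 0 <= visits r y E <= 1.
Proof.
rewrite /visits; apply/andP; split.
  by rewrite divr_ge0// sumr_ge0// => h _; have /andP[] := nat_bool01 (E (act h y)).
rewrite ler_pdivrMr ?b_gt0// mul1r; apply: ler_sum_size => h.
by have /andP[] := nat_bool01 (E (act h y)).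
Qed.

Lemma visitsT r y : visits r y [set: X] = 1.
Proof.
rewrite /visits (eq_bigr (fun=> 1)); last by move=> h _; rewrite asboolT.
by rewrite sumr_const_seq mulr1 divff// gt_eqF ?b_gt0.
Qed.

Lemma visitsU r y A B : A `&` B = set0 ->
  visits r y (A `|` B) = visits r y A + visits r y B.
Proof.
move=> AB; rewrite /visits -mulrDl -big_split; congr (_ / _); apply: eq_bigr => h _ /=.
case: asboolP => [[Ax|Bx]|nAB].
- rewrite (asboolT Ax) asboolF ?addr0// => Bx.
  by have : set0 (act h y) by rewrite -AB.
- rewrite (asboolT Bx) asboolF ?add0r// => Ax.
  by have : set0 (act h y) by rewrite -AB.
- by rewrite !asboolF ?addr0// => ?; apply: nAB; [right|left].
Qed.

(** Translating [L r] by [g] stays inside [L (r + N)], which has few further elements by the Følner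
    condition. *)
Lemma visits_preimage r n N y g E : g \in L n -> (n <= N)%N ->
  b (r + N) <= (1 + N.+1%:R^-1) * b r ->
  visits r y (act g @^-1` E) <= visits r y E + N.+1%:R^-1.
Proof.
move=> gn nN fol; rewrite /visits ler_pdivrMr ?b_gt0// mulrDl divfK ?gt_eqF ?b_gt0//.
under eq_bigr do rewrite /preimage /= -actM.
rewrite -(big_map (fun h => g * h)%g xpredT (fun h => (`[< E (act h y) >])%:R)).
apply: le_trans (_ : \sum_(h <- L (r + N)) (`[< E (act h y) >])%:R <= _).
  apply: ler_sum_subset => //.
  - by rewrite map_inj_uniq//; exact: mulgI.
  - move=> _ /mapP[h hr ->]; rewrite addnC; apply: L_mul => //.
    exact: L_mono nN _ gn.
apply: le_trans (ler_sum_superset (L_uniq r) (L_uniq _) _ _) _.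
- by apply: L_mono; rewrite leq_addr.
- by move=> h; have /andP[] := nat_bool01 (E (act h y)).
by rewrite lerD2l lerBlDl; move: fol; rewrite /b mulrDl mul1r.
Qed.

(** One parameter [N] controls both how Følner the ball must be and how large the gap per group
    element is. *)
Definition gap_at (u v : X -> R) (N : nat) := forall r, b (r + N) <= (1 + N.+1%:R^-1) * b r ->
  forall y, \sum_(h <- L r) u (act h y) + N.+1%:R^-1 * b r <= \sum_(h <- L r) v (act h y).

(* Otherwise long orbit segments visit a closed A' within A at least as often as
any closed subset of B; an ultralimit of their visit frequencies is an invariant
finitely additive mean, and the associated regular measure mu has mu(B) <=
mu(A). *)
Lemma density_gap (C A B : set X) : closed C -> open A -> open B -> C `<=` A ->
  (forall mu : probability (g_sigma_algebraType (@open X)) R, invariant_measure act mu ->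
     (mu A < mu B)%E) ->
  exists (u v : X -> R) (N : nat),
    [/\ continuous u /\ continuous v,
        forall x, 0 <= u x <= 1, forall x, 0 <= v x < 1,
        (forall x, C x -> u x = 1) /\ (forall x, 0 < v x -> B x) & gap_at u v N].
Proof.
move=> cC oA oB CA muAB.
have nA_closed : closed (~` A) by rewrite closedC.
have CnA : C `&` ~` A = set0 by rewrite -subset0 => x [/CA].
have [V1 [V2 [oV1 oV2 CV1 AV2 V12]]] := (@normal_openP R X).1 X_normal _ _ cC nA_closed CnA.
pose A' := ~` V2; have cA' : closed A' by rewrite closedC.
have A'A : A' `<=` A by move=> x nV2; apply: contrapT => /AV2.
have V1A' : V1 `<=` A' by move=> x V1x V2x; have : set0 x by rewrite -V12.
have [u [cu u01 uC u0]] := bump_function R X_normal cC oV1 CV1.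
pose good (p : set X * nat) := closed p.1 /\ p.1 `<=` B.
(* This factor makes the capacity strictly less than 1 and tends to 1 with [N]. *)
pose w (N : nat) : R := 1 - N.+1%:R^-1.
have iN0 N : 0 < N.+1%:R^-1 :> R by rewrite invr_gt0.
have iN1 N : N.+1%:R^-1 <= 1 :> R by rewrite invf_le1// ler1n.
apply: contrapT => nogap.
(* For a good pair, [u] and a scaled bump function of [K] fail to have a gap; [f] records the radius
   and the point of the failure, with a default value for other pairs. *)
have /choice[f Hf] : forall p : set X * nat, exists q : nat * X, good p ->
    b (q.1 + p.2) <= (1 + p.2.+1%:R^-1) * b q.1 /\
    w p.2 * visits q.1 q.2 p.1 <= visits q.1 q.2 A' + p.2.+1%:R^-1.
  move=> [K N].
  have [[/= cK KB]|nK] := pselect (good (K, N)); last by exists (0%N, point).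
  have [g [cg g01 gK gB]] := bump_function R X_normal cK oB KB.
  apply: contrapT => nq; apply: nogap; exists u, (fun x => w N * g x), N; split=> //.
  - by split=> // x; apply: cvgM; [exact: cvg_cst|exact: cg].
  - move=> x; have /andP[g0 g1] := g01 x; rewrite mulr_ge0 ?subr_ge0//=.
    by rewrite (le_lt_trans (ler_piMr _ g1))// ?subr_ge0// ltrBlDr ltrDl.
  - split=> // x wg; apply: contrapT => /gB g0; move: wg.
    by rewrite g0 mulr0 ltxx.
  move=> r fol y; rewrite leNgt; apply/negP => lt; apply: nq; exists (r, y) => _ /=.
  split=> //; rewrite /visits mulrA -[X in _ <= _ + X](mulfK (lt0r_neq0 (b_gt0 r))).
  rewrite -mulrDl ler_pM2r ?invr_gt0 ?b_gt0//.
  apply: le_trans (_ : \sum_(h <- L r) (w N * g (act h y)) <= _).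
    rewrite mulr_sumr; apply: ler_sum => h _; rewrite ler_wpM2l ?subr_ge0//.
    by case: asboolP => [/gK ->//|_]; have /andP[] := g01 (act h y).
  apply: le_trans (ltW lt) _; rewrite lerD2r; apply: ler_sum => h _.
  case: asboolP => [_|nA']; first by have /andP[] := u01 (act h y).
  by rewrite u0// => /V1A'.
(* Good pairs are directed by enlarging [K] and [N]. Limits along an ultrafilter refining the tails
   handle all closed subsets of [B] at once. *)
pose F := filter_from good (fun p => [set q | good q /\ p.1 `<=` q.1 /\ (p.2 <= q.2)%N]).
have FF : ProperFilter F.
  apply: filter_from_proper; last by move=> p gp; exists p; split=> //; split.
  apply: filter_from_filter; first by exists (set0, 0%N); split; [exact: closed0|exact: sub0set].
  move=> [K1 N1] [K2 N2] [/= cK1 K1B] [/= cK2 K2B]; exists (K1 `|` K2, maxn N1 N2).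
    by split=> /=; [exact: closedU|rewrite subUset].
  move=> [K N] [gK /= [KK NN]]; split; split=> //=.
  - by split; [move=> x K1x; apply: KK; left|apply: leq_trans (leq_maxl _ _) NN].
  - by split; [move=> x K2x; apply: KK; right|apply: leq_trans (leq_maxr _ _) NN].
have [U [UF FU]] := ultraFilterLemma FF.
have eventually_good (K : set X) N : closed K -> K `<=` B ->
    U [set q | good q /\ K `<=` q.1 /\ (N <= q.2)%N].
  by move=> cK KB; apply: FU; exists (K, N).
have small e : 0 < e -> exists N : nat, forall n, (N <= n)%N -> n.+1%:R^-1 <= e :> R.
  move=> e0; exists (Num.bound e^-1) => n nN.
  rewrite -[e]invrK lef_pV2 ?posrE ?invr_gt0//.
  apply: le_trans (ltW (archi_boundP _)) _; first by rewrite invr_ge0 ltW.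
  by rewrite ler_nat ltnW.
pose vis E p := visits (f p).1 (f p).2 E.
have /choice[m Hm] : forall E, exists l, ulim U (vis E) l.
  by move=> E; apply: ulim_exists => p; exact: visits01.
have PU : ProperFilter U by exact: ultra_proper.
have m_ge0 E : 0 <= m E.
  apply: (ulim_le UF (ulim_cst UF 0) (Hm E)) => e e0; apply: filterS filterT => p _ /=.
  by have /andP[v0 _] := visits01 (f p).1 (f p).2 E; rewrite addr_ge0// ltW.
have mT : m [set: X] = 1.
  apply: (ulim_unique UF (Hm setT)); rewrite (_ : vis setT = fun=> 1).
    exact: ulim_cst.
  by apply/funext => p; exact: visitsT.
have mU E1 E2 : E1 `&` E2 = set0 -> m (E1 `|` E2) = m E1 + m E2.
  move=> E12; apply: (ulim_unique UF (Hm _)); have := ulimD UF (Hm E1) (Hm E2).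
  by congr ulim; apply/funext => p; rewrite /vis visitsU.
have m_le g E : m (act g @^-1` E) <= m E.
  apply: (ulim_le UF (Hm _) (Hm _)) => e e0.
  have [n gn] := L_gen g; have [N HN] := small e e0.
  apply: filterS (eventually_good set0 (maxn n N) (@closed0 _) (@sub0set _ _)).
  move=> p /= [gp [_]]; rewrite geq_max => /andP[np Np]; have [fol _] := Hf p gp.
  by apply: le_trans (visits_preimage _ _ gn np fol) _; rewrite lerD2l HN.
have m_inv g E : m (act g @^-1` E) = m E.
  apply/le_anti; rewrite m_le /=; have := m_le g^-1%g (act g @^-1` E).
  congr (m _ <= _); apply/seteqP; split=> x /=.
    by rewrite -actM mulgV; have [-> _] := act_action.
  by rewrite -actM mulgV; have [-> _] := act_action.
have mKA (K : set X) : closed K -> K `<=` B -> m K <= m A'.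
  move=> cK KB; apply: (ulim_le UF (Hm _) (Hm _)) => e e0.
  (* Two errors of size [p.2.+1%:R^-1] occur: one from the factor [w], one from the failed gap. *)
  have [N HN] := small (e / 2) (divr_gt0 e0 (ltr0Sn _ 1)).
  apply: filterS (eventually_good K N cK KB) => p /= [gp [Kp /HN Np]].
  have [_ le] := Hf p gp; rewrite /vis.
  have KpK : visits (f p).1 (f p).2 K <= visits (f p).1 (f p).2 p.1.
    rewrite /visits ler_pM2r ?invr_gt0 ?b_gt0//; apply: ler_sum => h _.
    case: asboolP => [/Kp Kx|_]; first by rewrite asboolT.
    by have /andP[] := nat_bool01 (p.1 (act h (f p).2)).
  have /andP[v0 v1] := visits01 (f p).1 (f p).2 p.1.
  have vN : p.2.+1%:R^-1 * visits (f p).1 (f p).2 p.1 <= p.2.+1%:R^-1.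
    by rewrite ler_piMr// ltW.
  move: le vN Np KpK; rewrite /w mulrBl mul1r.
  by move: (visits _ _ p.1) (visits _ _ A') (visits _ _ K) (p.2.+1%:R^-1 : R) => a1 a2 a3 i; lra.
have [mu [mu_inv muA muB]] := invariant_mean_measure X_compact X_normal m_ge0 mT mU act_action m_inv.
have := muAB mu mu_inv; rewrite ltNge => /negP; apply.
exact: le_trans (muB B (m A') oB mKA) (muA A' A cA' oA A'A).
Qed.

End DensityGap.

(** * Comparison from the gap and the choice of radii *)

Theorem theoremA (R : realType) (G : groupType) (X : ptopologicalType)
  (act : G -> X -> X) :
  finitely_generated G -> polynomial_growth G ->
  compact [set: X] -> metrizable X R ->
  continuous_action act -> minimal_action act ->
  forall A B : set X, open A -> open B ->
  (forall mu : probability (g_sigma_algebraType (@open X)) R, invariant_measure act mu ->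
     (mu A < mu B)%E) ->
  subequivalent act A B.
Proof.
move=> _ [S [S_sym [S_gen [K [d growth]]]]] X_compact X_metr act_action _ A B oA oB muAB C cC CA.
have X_normal := compact_normal (metrizable_hausdorff X_metr) X_compact.
have [act1 [actM act_cont]] := act_action.
have [L [L_uniq LE L_growth]] := word_ball_enum growth.
have L_mul m n g h : g \in L m -> h \in L n -> (g * h)%g \in L (m + n)%N.
  by move=> /LE gm /LE hn; apply/LE; exact: word_ballM.
have L_inv n g : g \in L n -> (g^-1)%g \in L n.
  by move=> /LE gn; apply/LE; exact: word_ballV.
have L1 n : 1%g \in L n by apply/LE; exact: word_ball1.
have L_mono m n : (m <= n)%N -> {subset L m <= L n}.
  by move=> mn g /LE gm; apply/LE; exact: word_ball_mono mn _ gm.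
have L_gen g : exists n, g \in L n by have [n gn] := S_gen g; exists n; apply/LE.
have [u [v [N [[cu cv] u01 v01 [uC vB] gap]]]] :=
  density_gap X_compact X_normal act_action L_uniq L_mul L1 L_mono L_gen cC oA oB CA muAB.
pose eps : R := N.+1%:R^-1; have eps_gt0 : 0 < eps by rewrite invr_gt0.
have size_gt0 n : (0 < size (L n))%N by case: (L n) (L1 n).
have size_mono m n : (m <= n)%N -> (size (L m) <= size (L n))%N.
  by move=> /L_mono; exact: uniq_leq_size.
(* The shift [s + N] serves twice: by [s], the previous radius, to bound what the earlier stages
   bring in, and by [N] to make the gap available at the new radius. *)
have /choice[next Hnext] : forall s, exists r, [/\ (s.*2 <= r)%N,
    (size (L (r + (s + N))))%:R <= (1 + eps / 2) * (size (L r))%:R &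
    (size (L (4 * r)) <= 8 ^ d.+1 * size (L r))%N].
  move=> s; apply: (@folner_doubling_scale R (fun n => size (L n)) K d) => //.
  by rewrite divr_gt0.
pose r j := iter j next 0%N.
have fol s j : (s <= r j + N)%N ->
    (size (L (r j.+1 + s)))%:R <= (1 + eps / 2) * (size (L (r j.+1)))%:R.
  move=> sle; have [_ H _] := Hnext (r j); apply: le_trans H.
  by rewrite ler_nat size_mono// leq_add2l.
have [|||||||||J HJ] := @greedy_exhausts G L L_uniq L_mul L_inv L1 R X act act1 actM L_mono
  u v r eps (8 ^ d.+1)%:R.
- by move=> x; have /andP[] := u01 x.
- by move=> x; have /andP[] := u01 x.
- by move=> x; have /andP[] := v01 x.
- by [].
- by rewrite ltr0n expn_gt0.
- by move=> j; have [] := Hnext (r j).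
- by move=> j; apply: fol; rewrite leq_addr.
- by move=> j; rewrite -natrM ler_nat; have [] := Hnext (r j).
- move=> j y; apply: gap; apply: le_trans (fol N j (leq_addl _ _)) _.
  by rewrite ler_wpM2r// lerD2l; move: eps_gt0; rewrite -/eps; lra.
apply: (exhausting_subequivalent act1 actM act_cont cu cv (gs := stages L r J)) => //.
- by move=> x; have /andP[] := u01 x.
- by move=> x; have /andP[] := v01 x.
- by move=> x; have /andP[] := v01 x.
- by move=> x /uC ->; split=> //; apply: le_lt_trans (HJ x) _.
Qed.
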